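(* Let $\mathbb{K}$ be a field of characteristic zero, let $n\ge 3$, and let $R_1$ be the $(n+2)$-dimensional Leibniz algebra over $\mathbb{K}$ with basis $\{e_1,\dots,e_n,x,y\}$ and multiplication $$[e_i,e_1]=e_{i+1}\ (2\le i\le n-1),\qquad [e_1,x]=e_1,\qquad [x,e_1]=-e_1,$$ $$[e_i,x]=(i-1)e_i\ (2\le i\le n),\qquad [e_i,y]=e_i\ (2\le i\le n),$$ all other products of basis elements being zero. Then every local automorphism of $R_1$ is an automorphism of $R_1$.
   Context: A Leibniz algebra over $\mathbb{K}$ is a $\mathbb{K}$-vector space $L$ with a bilinear product $[-,-]$ satisfying $[[x,y],z]=[[x,z],y]+[x,[y,z]]$ for all $x,y,z\in L$. An automorphism of an algebra $A$ is a bijective linear map $\varphi:A\to A$ with $\varphi([u,v])=[\varphi(u),\varphi(v)]$ for all $u,v\in A$. A linear map $\Phi:A\to A$ is called a local automorphism if for every $u\in A$ there exists an automorphism $\varphi_u:A\to A$ (depending on $u$) such that $\Phi(u)=\varphi_u(u)$. *)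

(* Defs.v *)
From HB Require Import structures.
From mathcomp Require Import all_boot all_order all_algebra.
From mathcomp Require Import zify.

Set Implicit Arguments.
Unset Strict Implicit.
Unset Printing Implicit Defensive.

Import GRing.Theory.
Local Open Scope ring_scope.

HB.mixin Record Lmodule_isLeibniz (K : fieldType) L of GRing.Lmodule K L := {
  bracket : L -> L -> L;
  bracket_linearl : forall v, linear (bracket^~ v);
  bracket_linearr : forall u, linear (bracket u);
  bracket_leibniz : forall u v w,
    bracket (bracket u v) w = bracket (bracket u w) v + bracket u (bracket v w)
}.

#[short(type="leibnizAlgType")]
HB.structure Definition LeibnizAlgebra (K : fieldType) :=
  { L of GRing.Lmodule K L & Lmodule_isLeibniz K L }.

Definition automorphism (K : fieldType) (L : leibnizAlgType K)
    (phi : L -> L) : Prop :=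
  [/\ linear phi, bijective phi &
      forall u v, phi (bracket u v) = bracket (phi u) (phi v)].

Definition local_automorphism (K : fieldType) (L : leibnizAlgType K)
    (Phi : L -> L) : Prop :=
  linear Phi /\
  forall u, exists2 phi : L -> L, automorphism phi & Phi u = phi u.

Definition R1 (K : fieldType) (n : nat) : Type := 'rV[K]_n.+2.

HB.instance Definition _ (K : fieldType) (n : nat) :=
  GRing.Lmodule.copy (R1 K n) 'rV[K]_n.+2.

Section R1_bracket.

Variables (K : fieldType) (n : nat).

(* The basis is ordered x, e_1, ..., e_n, y: index 0 is x, index i with
   1 <= i <= n is e_i, and index n.+1 is y. *)
Definition R1_basis (i : nat) : R1 K n := delta_mx 0 (inord i).

(* The product of the basis vectors of indices i and j; the cases are, in
   order, [e_i,e_1], [e_1,x], [x,e_1], [e_i,x], [e_i,y] and the others. *)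
Definition R1_table (i j : nat) : R1 K n :=
  if (2 <= i <= n.-1)%N && (j == 1)%N then R1_basis i.+1
  else if (i == 1)%N && (j == 0)%N then R1_basis 1
  else if (i == 0)%N && (j == 1)%N then - R1_basis 1
  else if (2 <= i <= n)%N && (j == 0)%N then (i.-1)%:R *: R1_basis i
  else if (2 <= i <= n)%N && (j == n.+1)%N then R1_basis i
  else 0.

Definition R1_bracket (u v : R1 K n) : R1 K n :=
  \sum_(i < n.+2) \sum_(j < n.+2) (u 0 i * v 0 j) *: R1_table i j.

Lemma R1_bracket_linearl v : linear (R1_bracket^~ v).
Proof.
move=> a u w; rewrite /R1_bracket scaler_sumr -big_split /=.
apply: eq_bigr => i _; rewrite scaler_sumr -big_split /=.
apply: eq_bigr => j _.
by rewrite !mxE scalerA -scalerDl mulrDl mulrA.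
Qed.

Lemma R1_bracket_linearr u : linear (R1_bracket u).
Proof.
move=> a v w; rewrite /R1_bracket scaler_sumr -big_split /=.
apply: eq_bigr => i _; rewrite scaler_sumr -big_split /=.
apply: eq_bigr => j _.
by rewrite !mxE scalerA -scalerDl mulrDr mulrCA.
Qed.

Lemma R1_bracket_delta (i j : 'I_n.+2) :
  R1_bracket (delta_mx 0 i) (delta_mx 0 j) = R1_table i j.
Proof.
rewrite /R1_bracket (bigD1 i) //= [X in _ + X]big1 => [|k nki]; last first.
  by rewrite big1 // => l _; rewrite !mxE (negPf nki) andbF mul0r scale0r.
rewrite addr0 (bigD1 j) //= [X in _ + X]big1 => [|l nlj]; last first.
  by rewrite !mxE (negPf nlj) andbF mulr0 scale0r.
by rewrite addr0 !mxE !eqxx mulr1 scale1r.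
Qed.

Lemma R1_bracket_basis (i j : nat) : (i < n.+2)%N -> (j < n.+2)%N ->
  R1_bracket (R1_basis i) (R1_basis j) = R1_table i j.
Proof. by move=> hi hj; rewrite R1_bracket_delta !inordK. Qed.

Lemma R1_linear_ext (f g : R1 K n -> R1 K n) : linear f -> linear g ->
  (forall i : nat, (i < n.+2)%N -> f (R1_basis i) = g (R1_basis i)) -> f =1 g.
Proof.
move=> lf lg fg u.
pose F : {linear R1 K n -> R1 K n} :=
  HB.pack f (GRing.isLinear.Build K _ _ _ f lf).
pose G : {linear R1 K n -> R1 K n} :=
  HB.pack g (GRing.isLinear.Build K _ _ _ g lg).
change (F u = G u); rewrite [u]row_sum_delta !linear_sum.
apply: eq_bigr => i _; rewrite !linearZ; congr (_ *: _).
by have := fg i (ltn_ord i); rewrite /R1_basis inord_val.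
Qed.

Lemma R1_bracketDl u v w :
  R1_bracket (u + v) w = R1_bracket u w + R1_bracket v w.
Proof. by have := R1_bracket_linearl w 1 u v; rewrite /= !scale1r. Qed.
Lemma R1_bracketDr u v w :
  R1_bracket u (v + w) = R1_bracket u v + R1_bracket u w.
Proof. by have := R1_bracket_linearr u 1 v w; rewrite !scale1r. Qed.
Lemma R1_bracket0l w : R1_bracket 0 w = 0.
Proof. by apply: (addrI (R1_bracket 0 w)); rewrite -R1_bracketDl !addr0. Qed.
Lemma R1_bracket0r w : R1_bracket w 0 = 0.
Proof. by apply: (addrI (R1_bracket w 0)); rewrite -R1_bracketDr !addr0. Qed.
Lemma R1_bracketZl a u w : R1_bracket (a *: u) w = a *: R1_bracket u w.
Proof.
by have := R1_bracket_linearl w a u 0; rewrite /= !addr0 R1_bracket0l addr0.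
Qed.
Lemma R1_bracketZr a u w : R1_bracket u (a *: w) = a *: R1_bracket u w.
Proof.
by have := R1_bracket_linearr u a w 0; rewrite !addr0 R1_bracket0r addr0.
Qed.
Lemma R1_bracketNl u w : R1_bracket (- u) w = - R1_bracket u w.
Proof. by rewrite -scaleN1r R1_bracketZl scaleN1r. Qed.
Lemma R1_bracketNr u w : R1_bracket u (- w) = - R1_bracket u w.
Proof. by rewrite -scaleN1r R1_bracketZr scaleN1r. Qed.

Let lin := (R1_bracketDl, R1_bracketDr, R1_bracketZl, R1_bracketZr,
            R1_bracketNl, R1_bracketNr, R1_bracket0l, R1_bracket0r).

Lemma R1_bracket_leibniz u v w :
  R1_bracket (R1_bracket u v) w =
  R1_bracket (R1_bracket u w) v + R1_bracket u (R1_bracket v w).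
Proof.
move: w; apply: R1_linear_ext => [a p q|a p q|k hk].
- by rewrite !lin.
- by rewrite !lin scalerDr addrACA.
move: v; apply: R1_linear_ext => [a p q|a p q|j hj].
- by rewrite !lin.
- by rewrite !lin scalerDr addrACA.
move: u; apply: R1_linear_ext => [a p q|a p q|i hi].
- by rewrite !lin.
- by rewrite !lin scalerDr addrACA.
rewrite !R1_bracket_basis // /R1_table.
move: i hi j hj k hk => [|[|i]] hi [|[|j]] hj [|[|k]] hk /=;
  do ?[case: ifP => ?]; try (exfalso; lia);
  rewrite ?lin ?R1_bracket_basis ?/R1_table /=; try lia;
  do ?[case: ifP => ?]; try (exfalso; lia);
  rewrite ?addr0 ?add0r ?subrr ?addNr ?oppr0 ?scaler0 //.
- by rewrite (mulrSr 1 i.+1) scalerDl scale1r addrK.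
- by rewrite (mulrSr 1 i.+1) scalerDl scale1r.
- by rewrite addr0.
Qed.

End R1_bracket.

HB.instance Definition _ (K : fieldType) (n : nat) :=
  Lmodule_isLeibniz.Build K (R1 K n) (@R1_bracket_linearl K n)
    (@R1_bracket_linearr K n) (@R1_bracket_leibniz K n).

(* Main.v *)
(* Every automorphism phi preserves the ideal I = <e_2, ..., e_n>, which is the
   right annihilator of R1, and comparing coordinates in a few brackets gives
   phi y = y, phi e_1 = alpha e_1, phi x = x + beta e_1. Moreover, if beta = 0
   then every e_i with i >= 2 is an eigenvector of phi, because it spans an
   eigenspace of the right multiplication by x on I.
   Let Phi be a local automorphism, u0 = x + e_2 + ... + e_n and phi an
   automorphism with Phi u0 = phi u0. Then Psi = phi^-1 Phi is a local
   automorphism fixing u0, and Psi = id: the e_1-coordinate of Psi u0 gives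
   Psi x = x, testing on x + e_i shows that e_i is an eigenvector of Psi, with
   eigenvalue 1 since Psi fixes u0, and testing on x - e_1 + e_2 + e_3 gives
   Psi e_1 = e_1. *)
Require Import Defs.
From mathcomp Require Import all_boot all_order all_algebra.
From mathcomp Require Import ring zify.

Set Implicit Arguments.
Unset Strict Implicit.
Unset Printing Implicit Defensive.

Import GRing.Theory.
Local Open Scope ring_scope.

(** * Coordinates, and the bracket in coordinates *)

(** Natural-number indices leave index arithmetic to [lia]. Out of range, [inord] falls back to the
    index 0 of x, hence the bounds [k < n.+2] in the lemmas. *)
Definition coeff (K : fieldType) (n : nat) (u : R1 K n) (k : nat) : K :=
  u 0 (inord k).

Lemma coeffP (K : fieldType) (n : nat) (u v : R1 K n) :
  (forall k, (k < n.+2)%N -> coeff u k = coeff v k) -> u = v.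
Proof.
move=> uv; apply/rowP => i.
by have := uv i (ltn_ord i); rewrite /coeff inord_val.
Qed.

Lemma coeffD (K : fieldType) (n : nat) (u v : R1 K n) k :
  coeff (u + v) k = coeff u k + coeff v k.
Proof. exact: mxE. Qed.

Lemma coeffN (K : fieldType) (n : nat) (u : R1 K n) k :
  coeff (- u) k = - coeff u k.
Proof. exact: mxE. Qed.

Lemma coeffZ (K : fieldType) (n : nat) a (u : R1 K n) k :
  coeff (a *: u) k = a * coeff u k.
Proof. exact: mxE. Qed.

Lemma coeff0 (K : fieldType) (n : nat) k : coeff (0 : R1 K n) k = 0.
Proof. exact: mxE. Qed.

Lemma coeff_basis (K : fieldType) (n i k : nat) :
  (i < n.+2)%N -> (k < n.+2)%N -> coeff (R1_basis K n i) k = (k == i)%:R.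
Proof.
by move=> hi hk; rewrite /coeff /R1_basis mxE eqxx -val_eqE /= !inordK.
Qed.

(** The product has no x- or y-coordinate. On I, right multiplication by v is bidiagonal: v_1 times
    the shift, plus the diagonal entries (k-1) v_x + v_y. The exception at [k == 2] reflects
    [e_1,e_1] = 0: the shift starts at e_2. *)
Definition bracket_coeff (K : fieldType) (n : nat) (u v : R1 K n) (k : nat) :=
  if k == 1 then coeff u 1 * coeff v 0 - coeff u 0 * coeff v 1
  else if (2 <= k <= n)%N then
    (if k == 2 then 0 else coeff u k.-1 * coeff v 1)
      + coeff u k * ((k.-1)%:R * coeff v 0 + coeff v n.+1)
  else 0.

(** Both sides are bilinear, so a comparison on pairs of basis vectors suffices. *)
Lemma coeff_bracket (K : fieldType) (n : nat) (u v : R1 K n) k :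
  (k < n.+2)%N -> coeff (bracket u v) k = bracket_coeff u v k.
Proof.
move=> hk; pose B (p q : R1 K n) : R1 K n := \row_(l < n.+2) bracket_coeff p q l.
have coeffB p q : forall l, (l < n.+2)%N -> coeff (B p q) l = bracket_coeff p q l.
  by move=> l hl; rewrite /coeff mxE inordK.
suff -> : bracket u v = B u v by exact: coeffB.
move: v; apply: R1_linear_ext => [|a p q|j hj].
- exact: bracket_linearr.
- apply: coeffP => l hl; rewrite coeffD coeffZ !coeffB //.
  by rewrite /bracket_coeff !coeffD !coeffZ; do ?case: ifP => _; ring.
move: u; apply: R1_linear_ext => [|a p q|i hi].
- exact: (bracket_linearl (R1_basis K n j)).
- apply: coeffP => l hl; rewrite coeffD coeffZ !coeffB //.
  by rewrite /bracket_coeff !coeffD !coeffZ; do ?case: ifP => _; ring.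
rewrite [LHS]R1_bracket_basis //; apply: coeffP => l hl.
rewrite coeffB // /bracket_coeff /R1_table.
rewrite !coeff_basis //; try lia.
move: i hi j hj l hl => [|[|i]] hi [|[|j]] hj [|[|l]] hl /=;
  do ?case: ifP => ?; try (exfalso; lia);
  rewrite ?coeffN ?coeffZ ?coeff0; do ?[rewrite coeff_basis //; try lia].
all: do ?[case: eqP => ?]; try (exfalso; lia); subst; rewrite /=; try ring.
all: by have -> : l = i; [lia | ring].
Qed.

(** * Characteristic zero, linear maps, and composition of automorphisms *)

Lemma natr_inj_pchar0 (K : fieldType) :
  [pchar K] =i pred0 -> injective (fun m : nat => m%:R : K).
Proof.
move=> /pcharf0P char0 m p /eqP.
wlog mp : m p / (m <= p)%N => [W|].
  by case: (leqP m p) => [/W //|/ltnW/W pm mp]; rewrite pm // eq_sym.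
rewrite eq_sym -subr_eq0 -natrB // char0 subn_eq0 => pm.
by apply: anti_leq; rewrite mp.
Qed.

Lemma linear_semiadditive (K : fieldType) (V W : lmodType K) (f : V -> W) :
  linear f -> forall u v, f (u + v) = f u + f v.
Proof. by move=> lf u v; have := lf 1 u v; rewrite !scale1r. Qed.

Lemma linear_map0 (K : fieldType) (V W : lmodType K) (f : V -> W) :
  linear f -> f 0 = 0.
Proof.
by move=> lf; apply: (addrI (f 0)); rewrite -(linear_semiadditive lf) !addr0.
Qed.

Lemma linear_scale (K : fieldType) (V W : lmodType K) (f : V -> W) :
  linear f -> forall a u, f (a *: u) = a *: f u.
Proof.
by move=> lf a u; rewrite -[a *: u]addr0 lf (linear_map0 lf) addr0.
Qed.

Lemma automorphism_inverse (K : fieldType) (L : leibnizAlgType K)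
    (phi psi : L -> L) :
  automorphism phi -> cancel phi psi -> cancel psi phi -> automorphism psi.
Proof.
case=> lin_phi bij_phi phiM phiK psiK; split.
- move=> a u v; apply: (bij_inj bij_phi).
  by rewrite lin_phi !psiK.
- by exists phi.
- by move=> u v; apply: (bij_inj bij_phi); rewrite phiM !psiK.
Qed.

Lemma automorphism_comp (K : fieldType) (L : leibnizAlgType K)
    (phi psi : L -> L) :
  automorphism phi -> automorphism psi -> automorphism (phi \o psi).
Proof.
case=> lin_phi bij_phi phiM [lin_psi bij_psi psiM]; split.
- by move=> a u v /=; rewrite lin_psi lin_phi.
- exact: bij_comp.
- by move=> u v /=; rewrite psiM phiM.
Qed.

Lemma local_automorphism_comp (K : fieldType) (L : leibnizAlgType K)
    (phi Phi : L -> L) :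
  automorphism phi -> local_automorphism Phi -> local_automorphism (phi \o Phi).
Proof.
move=> auto_phi [lin_Phi loc_Phi]; case: (auto_phi) => lin_phi _ _; split.
  by move=> a u v /=; rewrite lin_Phi lin_phi.
move=> u; have [psi auto_psi Phi_u] := loc_Phi u.
by exists (phi \o psi); [exact: automorphism_comp | rewrite /= Phi_u].
Qed.

(** * Right multiplications and the ideal I *)

Lemma coeff_bracket01 (K : fieldType) (n : nat) (u v : R1 K n) : (0 < n)%N ->
  [/\ coeff (bracket u v) 0 = 0,
      coeff (bracket u v) 1 = coeff u 1 * coeff v 0 - coeff u 0 * coeff v 1 &
      coeff (bracket u v) n.+1 = 0].
Proof.
move=> n_gt0; rewrite !coeff_bracket // /bracket_coeff; split=> //=.
by do ?[case: ifP => ?]; try (exfalso; lia).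
Qed.

Lemma coeff_bracket2 (K : fieldType) (n : nat) (u v : R1 K n) : (2 <= n)%N ->
  coeff (bracket u v) 2 = coeff u 2 * (coeff v 0 + coeff v n.+1).
Proof.
move=> hn; rewrite coeff_bracket //; last by lia.
by rewrite /bracket_coeff /= hn /= add0r mul1r.
Qed.

Lemma coeff_bracketS (K : fieldType) (n k : nat) (u v : R1 K n) :
  (2 <= k < n)%N ->
  coeff (bracket u v) k.+1 =
    coeff u k * coeff v 1 + coeff u k.+1 * (k%:R * coeff v 0 + coeff v n.+1).
Proof.
move=> hk; rewrite coeff_bracket //; last by lia.
by rewrite /bracket_coeff; do ?[case: ifP => ?]; try (exfalso; lia).
Qed.

Definition in_ideal (K : fieldType) (n : nat) (u : R1 K n) : Prop :=
  [/\ coeff u 0 = 0, coeff u 1 = 0 & coeff u n.+1 = 0].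

Lemma basis_in_ideal (K : fieldType) (n i : nat) : (2 <= i <= n)%N ->
  in_ideal (R1_basis K n i).
Proof.
by move=> hi; split; rewrite coeff_basis //; try lia; case: eqP => //; lia.
Qed.

(** Right multiplication by y is the projection onto I, which lets the I-part of a vector be read
    off from a product. *)
Lemma coeff_bracket_y (K : fieldType) (n k : nat) (u : R1 K n) :
  (2 <= k <= n)%N -> coeff (bracket u (R1_basis K n n.+1)) k = coeff u k.
Proof.
move=> hk; rewrite coeff_bracket ?/bracket_coeff; last by lia.
rewrite !coeff_basis // eqxx; do ?[case: ifP => ?]; try (exfalso; lia).
- by case: eqP; [lia | rewrite /= => _; ring].
- by do 2?[case: eqP; first lia]; rewrite /= => _ _; ring.
Qed.

Lemma bracket_y_ideal (K : fieldType) (n : nat) (u : R1 K n) : (3 <= n)%N ->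
  in_ideal u -> bracket u (R1_basis K n n.+1) = u.
Proof.
move=> hn [u0 u1 un]; apply: coeffP => k hk.
have [hk2|] := boolP (2 <= k <= n)%N; first exact: coeff_bracket_y.
move=> hk2; rewrite coeff_bracket // /bracket_coeff (negPf hk2) u0 u1 !mul0r subrr.
rewrite if_same.
have [->|[->|->]] : k = 0%N \/ k = 1%N \/ k = n.+1 by lia.
all: by rewrite ?u0 ?u1 ?un.
Qed.

(** Testing on e_2 and e_3 is enough: the two diagonal entries z_x + z_y and 2 z_x + z_y both equal
    s, and the off-diagonal entry z_1 vanishes. The case s = 0 describes the right annihilator, the
    case s = 1 locates the image of y modulo I. *)
Lemma right_scalar_coeff (K : fieldType) (n : nat) (s : K) (z : R1 K n) :
  (3 <= n)%N -> (forall w, in_ideal w -> bracket w z = s *: w) ->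
  [/\ coeff z 0 = 0, coeff z 1 = 0 & coeff z n.+1 = s].
Proof.
move=> hn Rz.
have I2 : in_ideal (R1_basis K n 2) by apply: basis_in_ideal; lia.
have I3 : in_ideal (R1_basis K n 3) by apply: basis_in_ideal; lia.
have := congr1 (fun w => coeff w 2) (Rz _ I2).
have := congr1 (fun w => coeff w 3) (Rz _ I2).
have := congr1 (fun w => coeff w 3) (Rz _ I3).
rewrite !(coeff_bracket2, coeff_bracketS) ?coeffZ ?coeff_basis //=; try lia.
rewrite !(mul0r, mul1r, mulr1, mulr0, add0r, addr0) => e33 e23 e22.
have z0 : coeff z 0 = 0.
  have -> : coeff z 0 = (2%:R * coeff z 0 + coeff z n.+1)
                        - (coeff z 0 + coeff z n.+1) by ring.
  by rewrite e33 e22 subrr.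
by split=> //; rewrite -e22 z0 add0r.
Qed.

Lemma ideal_right_annihilator (K : fieldType) (n : nat) (z : R1 K n) :
  (3 <= n)%N -> in_ideal z <-> (forall w, bracket w z = 0).
Proof.
move=> hn; split=> [[z0 z1 zn] w | ann_z]; last first.
  by apply: (@right_scalar_coeff K n 0 z) => // w _; rewrite ann_z scale0r.
apply: coeffP => k hk; rewrite coeff_bracket // coeff0 /bracket_coeff z0 z1 zn.
by rewrite !mulr0 subrr addr0 mulr0 addr0 !if_same.
Qed.

(** * The shape of automorphisms *)

Lemma automorphism_ideal (K : fieldType) (n : nat) (phi : R1 K n -> R1 K n) u :
  (3 <= n)%N -> automorphism phi -> in_ideal u -> in_ideal (phi u).
Proof.
move=> hn [lin_phi [psi phiK psiK] phiM] /(ideal_right_annihilator _ hn) ann_u.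
apply/(ideal_right_annihilator _ hn) => w.
by rewrite -[w]psiK -phiM ann_u (linear_map0 lin_phi).
Qed.

Lemma automorphism_y (K : fieldType) (n : nat) (phi : R1 K n -> R1 K n) :
  (3 <= n)%N -> automorphism phi ->
  phi (R1_basis K n n.+1) = R1_basis K n n.+1.
Proof.
move=> hn auto_phi; case: (auto_phi) => lin_phi [psi phiK psiK] phiM.
set y := R1_basis K n n.+1.
have auto_psi := automorphism_inverse auto_phi phiK psiK.
(* Since [phi] maps I onto itself, [phi y] acts on I from the right as the identity, as y does; this
   determines it modulo I. *)
have [z0 z1 zn] : [/\ coeff (phi y) 0 = 0, coeff (phi y) 1 = 0 &
                      coeff (phi y) n.+1 = 1].
  apply: right_scalar_coeff => // w Iw.
  rewrite scale1r -{1}[w]psiK -phiM bracket_y_ideal //.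
  exact: automorphism_ideal.
have yy : bracket y y = 0.
  by rewrite [LHS]R1_bracket_basis // /R1_table; do ?case: ifP => ? //; lia.
apply: coeffP => k hk; rewrite [RHS]coeff_basis //.
have [hk2|hk2] := boolP (2 <= k <= n)%N; last first.
  have [->|[->|->]] : k = 0%N \/ k = 1%N \/ k = n.+1 by lia.
  - by rewrite z0.
  - by rewrite z1; case: eqP => //; lia.
  - by rewrite zn eqxx.
(* The I-part of [phi y] equals that of [[phi y], [phi y]], which is zero because [y,y] = 0. *)
have := congr1 (fun w => coeff w k) (phiM y y).
rewrite yy (linear_map0 lin_phi) coeff0 coeff_bracket // /bracket_coeff.
rewrite hk2 z0 z1 zn; case: eqP => [k1|_]; first lia.
rewrite !mulr0 if_same !add0r mulr1 => <-.
by case: eqP => //; lia.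
Qed.

Lemma automorphism_x_e1 (K : fieldType) (n : nat) (phi : R1 K n -> R1 K n) :
  (3 <= n)%N -> automorphism phi ->
  exists alpha beta : K,
    phi (R1_basis K n 1) = alpha *: R1_basis K n 1 /\
    phi (R1_basis K n 0) = R1_basis K n 0 + beta *: R1_basis K n 1.
Proof.
move=> hn auto_phi; case: (auto_phi) => lin_phi [psi phiK psiK] phiM.
have phiy := automorphism_y hn auto_phi.
set x := R1_basis K n 0; set e1 := R1_basis K n 1.
set e := R1_basis K n in x e1 phiy *.
(* As [phi] fixes y, it preserves the kernel of the projection onto I. *)
have no_ideal u k : bracket u (e n.+1) = 0 -> (2 <= k <= n)%N ->
    coeff (phi u) k = 0.
  move=> uy hk; rewrite -(coeff_bracket_y (phi u) hk) -/e -phiy -phiM uy.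
  by rewrite (linear_map0 lin_phi) coeff0.
have xy : bracket x (e n.+1) = 0.
  by rewrite [LHS]R1_bracket_basis // /R1_table; do ?case: ifP => ? //; lia.
have e1y : bracket e1 (e n.+1) = 0.
  by rewrite [LHS]R1_bracket_basis // /R1_table; do ?case: ifP => ? //; lia.
have e1x : bracket e1 x = e1 by rewrite [LHS]R1_bracket_basis.
(* The relation e_1 = [e_1,x] makes [phi e1] a product, so its x- and y-coordinates vanish. *)
have phi_e1 : phi e1 = coeff (phi e1) 1 *: e1.
  have := phiM e1 x; rewrite e1x => phi_e1x.
  have [c0 _ cn] := coeff_bracket01 (phi e1) (phi x) (ltnW (ltnW hn)).
  apply: coeffP => k hk; rewrite coeffZ coeff_basis //.
  have [hk2|hk2] := boolP (2 <= k <= n)%N.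
    by rewrite (no_ideal _ _ e1y hk2); case: eqP => [|_]; [lia | rewrite mulr0].
  have [->|[->|->]] : k = 0%N \/ k = 1%N \/ k = n.+1 by lia.
  - by rewrite {1}phi_e1x c0 mulr0.
  - by rewrite mulr1.
  - by rewrite {1}phi_e1x cn; case: eqP => [|_]; [lia | rewrite mulr0].
set alpha := coeff (phi e1) 1 in phi_e1.
have alpha_neq0 : alpha != 0.
  apply/eqP => a0; have : e1 = 0.
    by apply: (can_inj phiK); rewrite phi_e1 a0 scale0r (linear_map0 lin_phi).
  move/(congr1 (fun u => coeff u 1)); rewrite coeff_basis // coeff0 /=.
  by apply/eqP; exact: oner_neq0.
have x0 : coeff (phi x) 0 = 1.
  have := congr1 (fun u => coeff u 1) (phiM e1 x).
  have [_ -> _] := coeff_bracket01 (phi e1) (phi x) (ltnW (ltnW hn)).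
  rewrite e1x phi_e1 !coeffZ !coeff_basis //= mulr1 mulr0 mul0r subr0.
  by rewrite -{1}[alpha]mulr1 => /(mulfI alpha_neq0).
have e2x : bracket (e 2) x = e 2.
  rewrite [LHS]R1_bracket_basis //; try lia.
  by rewrite /R1_table /= andbF ifT ?scale1r //; lia.
(* Otherwise no image under [phi] has an e_2-coordinate, against surjectivity: for i >= 3, e_i =
   [e_{i-1},e_1] goes to a right multiple of e_1, which has none. *)
have f2 : coeff (phi (e 2)) 2 != 0.
  apply/eqP => f20.
  (* The factor e_2 turns the coordinate functional into a map of R1 to itself, as [R1_linear_ext]
     requires. *)
  have : (fun u => coeff (phi u) 2 *: e 2) =1 (fun=> 0).
    apply: R1_linear_ext => [a u v|a u v|i hi].
    - by rewrite lin_phi coeffD coeffZ scalerDl scalerA.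
    - by rewrite scaler0 addr0.
    rewrite -/(e i); suff -> : coeff (phi (e i)) 2 = 0 by rewrite scale0r.
    have [->|[->|[->|[->|hi3]]]] : i = 0%N \/ i = 1%N \/ i = 2%N \/ i = n.+1
      \/ (3 <= i <= n)%N by lia.
    - by apply: no_ideal xy _; lia.
    - by apply: no_ideal e1y _; lia.
    - by [].
    - by rewrite phiy coeff_basis //; try lia; case: eqP => //; lia.
    have -> : e i = bracket (e i.-1) e1.
      rewrite [RHS]R1_bracket_basis //; try lia.
      by rewrite /R1_table eqxx andbT ifT ?prednK //; lia.
    rewrite phiM phi_e1 coeff_bracket2; last by lia.
    rewrite !coeffZ !coeff_basis //=; case: eqP => [|_]; first by lia.
    by rewrite !mulr0 addr0 mulr0.
  move/(_ (psi (e 2)))/(congr1 (fun u => coeff u 2)).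
  rewrite psiK coeffZ coeff0 coeff_basis //=; try lia.
  by rewrite mulr1; apply/eqP; exact: oner_neq0.
(* The e_2-coordinate of [e_2,x] = e_2 gives f = f (1 + c), with f the nonzero e_2-coordinate of
   [phi (e 2)] and c the y-coordinate of [phi x]. *)
have xn : coeff (phi x) n.+1 = 0.
  have := congr1 (fun u => coeff u 2) (phiM (e 2) x).
  rewrite e2x coeff_bracket2; last by lia.
  rewrite x0 -{1}[coeff _ _]mulr1 => /(mulfI f2).
  by rewrite -{1}[1]addr0 => /addrI.
exists alpha, (coeff (phi x) 1); split=> //.
apply: coeffP => k hk; rewrite coeffD coeffZ !coeff_basis //.
have [hk2|hk2] := boolP (2 <= k <= n)%N.
  rewrite (no_ideal _ _ xy hk2); do 2?[case: eqP => [|_]; first lia].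
  by rewrite mulr0 addr0.
have [->|[->|->]] : k = 0%N \/ k = 1%N \/ k = n.+1 by lia.
- by rewrite x0 mulr0 addr0.
- by rewrite mulr1 add0r.
- by rewrite xn; do 2?[case: eqP => [|_]; first lia]; rewrite mulr0 addr0.
Qed.

(** Obtained by applying [phi] to [e_2,x] = e_2 and [e_2,e_1] = e_3. These relations tie [alpha] and
    [beta] to the action on I, which later pins down a local automorphism at e_1. *)
Lemma automorphism_e2_e3 (K : fieldType) (n : nat) (phi : R1 K n -> R1 K n)
    (alpha beta : K) : (3 <= n)%N -> automorphism phi ->
  phi (R1_basis K n 1) = alpha *: R1_basis K n 1 ->
  phi (R1_basis K n 0) = R1_basis K n 0 + beta *: R1_basis K n 1 ->
  [/\ coeff (phi (R1_basis K n 2)) 3 = - (beta * coeff (phi (R1_basis K n 2)) 2),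
      coeff (phi (R1_basis K n 3)) 2 = 0 &
      coeff (phi (R1_basis K n 3)) 3 = alpha * coeff (phi (R1_basis K n 2)) 2].
Proof.
move=> hn [_ _ phiM] phi_e1 phi_x; set e := R1_basis K n in phi_e1 phi_x *.
have e2x : bracket (e 2) (e 0) = e 2.
  rewrite [LHS]R1_bracket_basis //; try lia.
  by rewrite /R1_table /= andbF ifT ?scale1r //; lia.
have e2e1 : bracket (e 2) (e 1) = e 3.
  rewrite [LHS]R1_bracket_basis //; try lia.
  by rewrite /R1_table ifT //; lia.
have n1 : n.+1 != 1 by lia.
split.
- have := congr1 (fun u => coeff u 3) (phiM (e 2) (e 0)).
  rewrite e2x phi_x coeff_bracketS; last by lia.
  rewrite !coeffD !coeffZ !coeff_basis //= (negPf n1) /= => E.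
  apply/eqP; rewrite -subr_eq0; apply/eqP.
  move/eqP: E; rewrite eq_sym -subr_eq0 => /eqP <-; ring.
- have := congr1 (fun u => coeff u 2) (phiM (e 2) (e 1)).
  rewrite e2e1 phi_e1 coeff_bracket2; last by lia.
  by move=> ->; rewrite !coeffZ !coeff_basis //= (negPf n1) /=; ring.
- have := congr1 (fun u => coeff u 3) (phiM (e 2) (e 1)).
  rewrite e2e1 phi_e1 coeff_bracketS; last by lia.
  by move=> ->; rewrite !coeffZ !coeff_basis //= (negPf n1) /=; ring.
Qed.

Lemma automorphism_fix_x (K : fieldType) (n i : nat)
    (phi : R1 K n -> R1 K n) :
  [pchar K] =i pred0 -> (3 <= n)%N -> automorphism phi ->
  phi (R1_basis K n 0) = R1_basis K n 0 -> (2 <= i <= n)%N ->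
  phi (R1_basis K n i) = coeff (phi (R1_basis K n i)) i *: R1_basis K n i.
Proof.
move=> charK hn auto_phi phi_x hi; set e := R1_basis K n in phi_x *.
have [lin_phi _ phiM] := auto_phi.
have [w0 w1 wn] := automorphism_ideal hn auto_phi (basis_in_ideal K hi).
have eix : bracket (e i) (e 0) = (i.-1)%:R *: e i.
  rewrite [LHS]R1_bracket_basis //; try lia.
  by rewrite /R1_table; do ?[case: ifP => ?]; try (exfalso; lia).
apply: coeffP => k hk; rewrite coeffZ coeff_basis //; last by lia.
case: eqP => [-> | ki]; first by rewrite mulr1.
rewrite mulr0.
have [hk2|hk2] := boolP (2 <= k <= n)%N; last first.
  by have [->|[->|->]] : k = 0%N \/ k = 1%N \/ k = n.+1 by lia.
have := congr1 (fun u => coeff u k) (phiM (e i) (e 0)).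
rewrite eix phi_x (linear_scale lin_phi) coeffZ coeff_bracket //.
rewrite /bracket_coeff hk2 !coeff_basis //=.
case: eqP => [|_]; first lia.
(* The e_k-coordinate c of [phi (e i)] satisfies (i-1) c = (k-1) c, and the two integers differ in
   K. *)
rewrite mulr0 if_same add0r mulr1 addr0 mulrC => /eqP.
rewrite -subr_eq0 -mulrBr mulf_eq0 => /orP[/eqP //|].
rewrite subr_eq0 => /eqP/(natr_inj_pchar0 charK); lia.
Qed.

(** * Local automorphisms fixing x + e_2 + ... + e_n *)

Definition ideal_ones (K : fieldType) (n : nat) : R1 K n :=
  \row_(k < n.+2) (2 <= k <= n)%:R.

Lemma coeff_ideal_ones (K : fieldType) (n k : nat) : (k < n.+2)%N ->
  coeff (ideal_ones K n) k = (2 <= k <= n)%:R.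
Proof. by move=> hk; rewrite /coeff mxE inordK. Qed.

Lemma ideal_ones_in_ideal (K : fieldType) (n : nat) : in_ideal (ideal_ones K n).
Proof.
by split; rewrite coeff_ideal_ones //; case: andP => // -[]; lia.
Qed.

Lemma local_automorphism_fix (K : fieldType) (n : nat)
    (Psi : R1 K n -> R1 K n) :
  [pchar K] =i pred0 -> (3 <= n)%N -> local_automorphism Psi ->
  Psi (R1_basis K n 0 + ideal_ones K n) = R1_basis K n 0 + ideal_ones K n ->
  Psi =1 id.
Proof.
move=> charK hn [lin_Psi loc_Psi] Psi_u0; set e := R1_basis K n in Psi_u0 *.
have PsiD := linear_semiadditive lin_Psi.
have Psi_ideal w : in_ideal w -> in_ideal (Psi w).
  by move=> Iw; have [phi auto_phi ->] := loc_Psi w; exact: automorphism_ideal.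
have Psi_y : Psi (e n.+1) = e n.+1.
  by have [phi auto_phi ->] := loc_Psi (e n.+1); exact: automorphism_y.
have [alpha Psi_e1] : exists alpha, Psi (e 1) = alpha *: e 1.
  have [phi auto_phi ->] := loc_Psi (e 1).
  by have [alpha [_ [-> _]]] := automorphism_x_e1 hn auto_phi; exists alpha.
have Psi_x : Psi (e 0) = e 0.
  have [phi auto_phi phi_x] := loc_Psi (e 0).
  have [_ [beta [_]]] := automorphism_x_e1 hn auto_phi.
  rewrite -phi_x -/e => Psi_x.
  have := congr1 (fun u => coeff u 1) Psi_u0.
  have [_ w1 _] := ideal_ones_in_ideal K n.
  have [_ Pw1 _] := Psi_ideal _ (ideal_ones_in_ideal K n).
  rewrite PsiD Psi_x !coeffD w1 Pw1 coeffZ !coeff_basis //= mulr1 !addr0 add0r.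
  by move=> ->; rewrite scale0r addr0.
have Psi_ones : Psi (ideal_ones K n) = ideal_ones K n.
  by apply: (addrI (e 0)); rewrite -Psi_u0 PsiD Psi_x.
have Psi_diag i : (2 <= i <= n)%N -> Psi (e i) = coeff (Psi (e i)) i *: e i.
  move=> hi; have [phi auto_phi] := loc_Psi (e 0 + e i).
  have [lin_phi _ _] := auto_phi.
  have Ii := basis_in_ideal K hi.
  rewrite PsiD (linear_semiadditive lin_phi) Psi_x => phi_xi.
  have [_ [beta [_]]] := automorphism_x_e1 hn auto_phi; rewrite -/e => phi_x.
  have := congr1 (fun u => coeff u 1) phi_xi.
  have [_ w1 _] := automorphism_ideal hn auto_phi Ii.
  have [_ Pw1 _] := Psi_ideal _ Ii.
  (* The I-parts contribute nothing to the e_1-coordinate, so [beta] = 0 and this [phi] fixes x. *)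
  rewrite phi_x !coeffD w1 Pw1 coeffZ !coeff_basis //= mulr1 !addr0 add0r => b0.
  have phi_x0 : phi (e 0) = e 0 by rewrite phi_x -b0 scale0r addr0.
  have -> : Psi (e i) = phi (e i).
    by move: phi_xi; rewrite phi_x0 => /addrI.
  exact: automorphism_fix_x.
have Psi_e i : (2 <= i <= n)%N -> Psi (e i) = e i.
  move=> hi; rewrite Psi_diag //.
  (* [Psi] is diagonal outside index i as well, so the i-th coordinate is just scaled by the
     eigenvalue; evaluation at the fixed vector [ideal_ones] shows that the eigenvalue is 1. *)
  have : (fun u => coeff (Psi u) i *: e i) =1
         (fun u => (coeff (Psi (e i)) i * coeff u i) *: e i).
    apply: R1_linear_ext => [a u v|a u v|k hk].
    - by rewrite lin_Psi coeffD coeffZ scalerDl scalerA.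
    - rewrite coeffD coeffZ scalerA -scalerDl; congr (_ *: _); ring.
    rewrite -/(e k) (@coeff_basis K n k) //; last by lia.
    case: eqP => [->|ik]; first by rewrite mulr1.
    rewrite mulr0 scale0r; suff -> : coeff (Psi (e k)) i = 0 by rewrite scale0r.
    have [->|[->|[->|hk2]]] : k = 0%N \/ k = 1%N \/ k = n.+1 \/ (2 <= k <= n)%N
      by lia.
    - by rewrite Psi_x coeff_basis //; [case: eqP => //|]; lia.
    - rewrite Psi_e1 coeffZ coeff_basis //; [|lia].
      by case: eqP => [|_]; [lia | rewrite mulr0].
    - by rewrite Psi_y coeff_basis //; [case: eqP => //|]; lia.
    - rewrite Psi_diag // coeffZ coeff_basis //; try lia.
      by case: eqP => [|_]; [lia | rewrite mulr0].
  move/(_ (ideal_ones K n))/(congr1 (fun u => coeff u i)).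
  rewrite Psi_ones !coeffZ coeff_ideal_ones; last by lia.
  rewrite hi coeff_basis; [|lia|lia].
  by rewrite eqxx !mulr1 => <-; rewrite scale1r.
have alpha1 : alpha = 1.
  (* The e_1-coordinate gives - alpha = beta - alpha'. The e_2-coordinate of [phi (e 2)] is 1, so
     the e_3-coordinate gives 1 = alpha' - beta. The sign of e_1 makes the same combination appear
     twice. *)
  have [phi auto_phi] := loc_Psi (e 0 + -1 *: e 1 + e 2 + e 3).
  have [lin_phi _ _] := auto_phi.
  rewrite !PsiD !(linear_semiadditive lin_phi).
  rewrite (linear_scale lin_Psi) (linear_scale lin_phi).
  rewrite Psi_x Psi_e1 !Psi_e; try lia.
  have [alpha' [beta [phi_e1 phi_x]]] := automorphism_x_e1 hn auto_phi.
  have [e23 e32 e33] := automorphism_e2_e3 hn auto_phi phi_e1 phi_x.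
  have I2 : in_ideal (e 2) by apply: basis_in_ideal; lia.
  have I3 : in_ideal (e 3) by apply: basis_in_ideal; lia.
  have [_ e21 _] := automorphism_ideal hn auto_phi I2.
  have [_ e31 _] := automorphism_ideal hn auto_phi I3.
  move=> E.
  have := congr1 (fun u => coeff u 1) E.
  have := congr1 (fun u => coeff u 2) E.
  have := congr1 (fun u => coeff u 3) E.
  rewrite /e phi_x phi_e1 !(coeffD, coeffZ).
  rewrite e23 e32 e33 e21 e31 !coeff_basis //=; try lia.
  rewrite !(mulr0, mulr1, add0r, addr0) => E3 E2 E1.
  rewrite -[coeff _ 2]E2 !mulr1 in E3.
  transitivity (- (-1 * alpha)); first by ring.
  by rewrite E1; transitivity (- beta + alpha'); [ring | exact: esym E3].
have Psi_id : Psi =1 id.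
  apply: R1_linear_ext => // i hi; rewrite -/(e i).
  have [->|[->|[->|hk2]]] : i = 0%N \/ i = 1%N \/ i = n.+1 \/ (2 <= i <= n)%N
    by lia.
  - exact: Psi_x.
  - by rewrite Psi_e1 alpha1 scale1r.
  - exact: Psi_y.
  - exact: Psi_e.
exact: Psi_id.
Qed.

(** * Reduction to a local automorphism with a fixed vector *)

Theorem theorem3p2 (K : fieldType) (n : nat) (charK : [pchar K] =i pred0)
    (hn : (3 <= n)%N) (Phi : R1 K n -> R1 K n) :
  local_automorphism Phi -> automorphism Phi.
Proof.
move=> loc_Phi; have [lin_Phi loc] := loc_Phi.
have [phi auto_phi Phi_u0] := loc (R1_basis K n 0 + ideal_ones K n).
have [_ [psi phiK psiK] phiM] := auto_phi.
have auto_psi := automorphism_inverse auto_phi phiK psiK.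
have psi_Phi : psi \o Phi =1 id.
  apply: (local_automorphism_fix charK hn).
    exact: local_automorphism_comp.
  by rewrite /= Phi_u0 phiK.
have PhiE : Phi =1 phi.
  by move=> u; rewrite -[LHS]psiK -[psi _]/((psi \o Phi) u) psi_Phi.
split=> //.
- by apply: (@eq_bij _ _ phi) => [|u]; [exists psi | rewrite PhiE].
- by move=> u v; rewrite !PhiE phiM.
Qed.
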